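(* Consider the second order difference equation $$x_{n+1}=1+\frac{x_{n-1}}{x_n},\qquad n=0,1,2,\ldots,$$ with positive initial conditions $x_{-1},x_0$, let $T(x,y)=\left(y,1+\frac{x}{y}\right)$ be its associated map on $(0,\infty)^2$, and let $\mathcal{H}=\{(x,y)\in(0,\infty)^2:x+y=xy\}$. The following statements are true. (i) Every solution converges to a period-two solution $(\overline{x},\overline{y})\in\mathcal{H}$. (ii) For every period-two solution $(\overline{x},\overline{y})\in\mathcal{H}$, the stable set $\mathcal{W}^s_{(\overline{x},\overline{y})}$ is an unbounded increasing curve $\mathcal{C}_{(\overline{x},\overline{y})}$. (iii) The limiting period-two solution $(\overline{x},\overline{y})$ depends continuously on the initial condition.
   Context: The map $T$ acts on pairs $(x_{n-1},x_n)$. $\mathcal{H}$ is the set of fixed points of $T^2(x,y)=\left(1+\frac{x}{y},1+\frac{y^2}{x+y}\right)$; its elements are referred to as period-two solutions (including the equilibrium $(2,2)$). Convergence of a solution with initial condition $\mathrm{x}=(x_{-1},x_0)$ to $(\overline{x},\overline{y})\in\mathcal{H}$ means $T^{2n}(\mathrm{x})\to(\overline{x},\overline{y})$ as $n\to\infty$, and $\mathcal{W}^s_{(\overline{x},\overline{y})}=\{\mathrm{x}\in(0,\infty)^2:T^{2n}(\mathrm{x})\to(\overline{x},\overline{y})\}$. An increasing curve is the graph of a strictly increasing continuous function of the first coordinate on an interval. Statement (iii) means that $\mathrm{x}\mapsto\lim_{n\to\infty}T^{2n}(\mathrm{x})$ is continuous on $(0,\infty)^2$. *)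

(* Defs.v *)
From HB Require Import structures.
From mathcomp Require Import all_boot all_order all_algebra.
From mathcomp Require Import all_classical all_reals all_analysis.
From mathcomp Require Import ring lra.

Set Implicit Arguments.
Unset Strict Implicit.
Unset Printing Implicit Defensive.

Import Order.TTheory GRing.Theory Num.Theory.
Import numFieldNormedType.Exports.

Local Open Scope classical_set_scope.
Local Open Scope ring_scope.

Definition pos_quadrant (R : realType) : set (R * R) :=
  [set p | 0 < p.1 /\ 0 < p.2].

(* The sequence is shifted by one: x n stands for x_{n-1}, so the initial
   conditions x_{-1}, x_0 are x 0 and x 1. *)
Definition is_solution (R : realType) (x : nat -> R) : Prop :=
  [/\ 0 < x 0%N, 0 < x 1%N & forall n : nat, x n.+2 = 1 + x n / x n.+1].

Definition T (R : realType) (p : R * R) : R * R := (p.2, 1 + p.1 / p.2).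

Definition even_iterates (R : realType) (p : R * R) : nat -> R * R :=
  fun n => iter n.*2 (@T R) p.

Definition period_two_set (R : realType) : set (R * R) :=
  [set p | pos_quadrant p /\ p.1 + p.2 = p.1 * p.2].

Definition stable_set (R : realType) (q : R * R) : set (R * R) :=
  [set p | pos_quadrant p /\ even_iterates p n @[n --> \oo] --> q].

(* The interval may be of any kind (open, closed, bounded or not). *)
Definition increasing_curve (R : realType) (C : set (R * R)) : Prop :=
  exists (I : set R) (f : R -> R),
    [/\ is_interval I,
        {within I, continuous f},
        (forall s t : R, I s -> I t -> s < t -> f s < f t)
      & C = [set p | I p.1 /\ p.2 = f p.1]].

(* This is what [lim] unfolds to; [lim] itself is not available here because
   products carry no pointed-filtered instance. The value is meaningful only at
   those p whose even iterates converge. *)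
Definition limit_map (R : realType) (p : R * R) : R * R :=
  [get q : R * R | even_iterates p n @[n --> \oo] --> q].

Lemma iter_T_solution (R : realType) (x : nat -> R) (n : nat) :
  is_solution x -> iter n (@T R) (x 0%N, x 1%N) = (x n, x n.+1).
Proof. by case=> _ _ xS; elim: n => //= n ->; rewrite /T /= -xS. Qed.

Lemma T2E (R : realType) (x y : R) : 0 < x -> 0 < y ->
  T (T (x, y)) = (1 + x / y, 1 + y ^+ 2 / (x + y)).
Proof.
move=> x0 y0; rewrite /T /=; congr (_, _ + _).
have xy0 : 0 < x + y by apply: addr_gt0.
by field; rewrite !gt_eqF //= addrC.
Qed.

Lemma period_two_setE (R : realType) :
  @period_two_set R = [set p | pos_quadrant p /\ T (T p) = p].
Proof.
apply/seteqP; split => -[x y] [[/= x0 y0]] H; split => //; move: H; rewrite /= T2E //.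
- have xy0 : x + y != 0 by rewrite gt_eqF // addr_gt0.
  have yn0 : y != 0 by rewrite gt_eqF.
  move=> E; congr (_, _).
    by apply: (mulIf yn0); rewrite mulrDl mul1r divfK // -E addrC.
  apply: (mulIf xy0); rewrite mulrDl mul1r divfK // mulrDr.
  by rewrite [y * x]mulrC -E -expr2.
- have yn0 : y != 0 by rewrite gt_eqF.
  by case=> E _; rewrite -[in RHS]E mulrDl mul1r divfK // addrC.
Qed.

(* Main.v *)
(* In the coordinates (u, v) = (x, y / (y - 1)) on (1, oo)^2 the fixed points of
   T^2 are the diagonal. With w = 1 - 1/v = 1/y, T^2 becomes
     u' = w u + (1 - w) v,   v' = w^2 u + (1 - w^2) v,
   so that [min u v, max u v] shrinks while v' - u' = w (1 - w) (v - u), with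
   w (1 - w) <= 1/4. Hence (u, v) converges to a diagonal point (L, L), with an
   error controlled by |v - u|, which makes L continuous in the initial
   condition.
   In these coordinates T^2 is also order preserving, and on two ordered points
   the smaller of the two coordinate differences decreases at most by a factor
   1 - 2 |v - u|. As the |v - u| are summable, L is strictly monotone for the
   south-east order (x increasing, y decreasing). The stable sets are the level
   sets of L, so strict monotonicity, continuity and the intermediate value
   theorem make them increasing curves that leave every box. *)
Require Import Defs.
From HB Require Import structures.
From mathcomp Require Import all_boot all_order all_algebra.
From mathcomp Require Import all_classical all_reals all_analysis.
From mathcomp Require Import ring lra.
Import Order.TTheory GRing.Theory Num.Theory.
Import numFieldNormedType.Exports.
Local Open Scope classical_set_scope.
Local Open Scope ring_scope.
Set Implicit Arguments.
Unset Strict Implicit.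
Unset Printing Implicit Defensive.

(* The map T^2 in the coordinates (u, v) = (x, y / (y - 1)), in which the
   period-two solutions form the diagonal; the factor 1 - v^-1 is 1 / y. *)
Definition step (R : realType) (p : R * R) : R * R :=
  let w := 1 - p.2^-1 in let u := 1 + p.1 * w in (u, 1 + w * u).

Definition gap (R : realType) (p : R * R) : R := p.2 - p.1.

(* T^2 followed by (x, y) |-> (x, y / (y - 1)); a first application of T^2
   is needed because these coordinates require y > 1. *)
Definition chart (R : realType) (p : R * R) : R * R :=
  let u := 1 + p.1 / p.2 in (u, 1 + p.2^-1 * u).

Definition unchart (R : realType) (p : R * R) : R * R :=
  (p.1, p.2 / (p.2 - 1)).

Definition orb (R : realType) (p : R * R) (n : nat) : R * R :=
  iter n (@step R) (chart p).

Definition limit_fst (R : realType) (p : R * R) : R :=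
  limn (fun n => (orb p n).1).

Lemma T2_chart (R : realType) (p : R * R) :
  pos_quadrant p -> T (T p) = unchart (chart p).
Proof.
case: p => x y [/= x0 y0]; rewrite T2E // /unchart /chart /=; congr (_, _).
have xy0 : 0 < x + y by apply: addr_gt0.
field; by rewrite !gt_eqF //=; nra.
Qed.

Lemma chart_unchart (R : realType) (p : R * R) :
  1 < p.2 -> chart (unchart p) = step p.
Proof.
case: p => u v /= v1; rewrite /chart /unchart /step /=.
have v10 : v - 1 != 0 by rewrite subr_eq0 gt_eqF.
have v0 : v != 0 by rewrite gt_eqF // (lt_trans ltr01).
by congr (_, _); field; rewrite v0 v10.
Qed.

Lemma chart_gt1 (R : realType) (p : R * R) :
  pos_quadrant p -> 1 < (chart p).1 /\ 1 < (chart p).2.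
Proof.
case: p => x y [/= x0 y0]; rewrite /chart /= !ltrDl.
have h : 0 < x / y by rewrite divr_gt0.
by split=> //; rewrite mulr_gt0 ?invr_gt0 ?addr_gt0.
Qed.

Lemma unchart_pos (R : realType) (p : R * R) :
  1 < p.1 -> 1 < p.2 -> pos_quadrant (unchart p).
Proof.
by move=> u1 v1; split=> /=; rewrite ?divr_gt0 ?subr_gt0 // (lt_trans ltr01).
Qed.

Lemma step_convex (R : realType) (p : R * R) : p.2 != 0 ->
  let w := 1 - p.2^-1 in
  step p = (w * p.1 + (1 - w) * p.2, w ^+ 2 * p.1 + (1 - w ^+ 2) * p.2).
Proof.
by case: p => u v /= v0; rewrite /step /=; congr (_, _); field.
Qed.

Lemma gap_step (R : realType) (p : R * R) : p.2 != 0 ->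
  gap (step p) = (1 - p.2^-1) * p.2^-1 * gap p.
Proof. by case: p => u v /= v0; rewrite /gap /step /=; field. Qed.

Lemma inv_gt1 (R : realType) (v : R) : 1 < v -> 0 < v^-1 /\ v^-1 < 1.
Proof.
by move=> v1; rewrite invr_gt0 invf_lt1 // (lt_trans ltr01).
Qed.

Lemma step_itv (R : realType) (a b : R) (p : R * R) : 1 < p.2 ->
  a <= p.1 <= b -> a <= p.2 <= b ->
  a <= (step p).1 <= b /\ a <= (step p).2 <= b.
Proof.
move=> v1; have v0 : p.2 != 0 by rewrite gt_eqF // (lt_trans ltr01).
rewrite step_convex //=; have [] := inv_gt1 v1.
move: (p.1) (p.2) (p.2^-1) => u v i i0 i1 /andP[au ub] /andP[av vb].
have conv t : 0 <= t <= 1 -> a <= t * u + (1 - t) * v <= b.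
  by case/andP=> t0 t1; apply/andP; split; nra.
by split; apply: conv; apply/andP; split; nra.
Qed.

Lemma step_gt1 (R : realType) (p : R * R) :
  1 < p.1 -> 1 < p.2 -> 1 < (step p).1 /\ 1 < (step p).2.
Proof.
case: p => u v /= u1 v1; rewrite /step /= !ltrDl; have [i0 i1] := inv_gt1 v1.
have w0 : 0 < 1 - v^-1 by lra.
have u0 : 0 < u by lra.
have uw0 : 0 < u * (1 - v^-1) by rewrite mulr_gt0.
by split=> //; rewrite mulr_gt0 // addr_gt0.
Qed.

Lemma gap_step_le (R : realType) (p : R * R) : 1 < p.2 ->
  `|gap (step p)| <= `|gap p| / 4.
Proof.
move=> v1; have v0 : p.2 != 0 by rewrite gt_eqF // (lt_trans ltr01).
rewrite gap_step // normrM mulrC ler_wpM2l //.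
have [i0 i1] := inv_gt1 v1; rewrite ger0_norm; last by nra.
have := sqr_ge0 (p.2^-1 - 1 / 2); nra.
Qed.

Lemma step_expand (R : realType) (m : R) (p q : R * R) :
  1 < p.1 -> 1 < p.2 -> 1 < q.1 -> 1 < q.2 -> 0 <= m ->
  m <= q.1 - p.1 -> m <= q.2 - p.2 ->
  m * (1 - 2 * `|gap p|) <= (step q).1 - (step p).1 /\
  m * (1 - 2 * `|gap p|) <= (step q).2 - (step p).2.
Proof.
case: p q => [u1 v1] [u2 v2] /= hu1 hv1 hu2 hv2 m0 mu mv.
have [a0 a1] := inv_gt1 hv1; have [b0 b1] := inv_gt1 hv2.
rewrite /step /gap /=.
set a := v1^-1 in a0 a1 *; set b := v2^-1 in b0 b1 *.
have av : a * v1 = 1 by rewrite mulVf // gt_eqF // (lt_trans ltr01).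
have bv : b * v2 = 1 by rewrite mulVf // gt_eqF // (lt_trans ltr01).
have ab0 : 0 < a * b by rewrite mulr_gt0.
have ab1 : a * b <= 1 by nra.
have dab : m * (a * b) <= a - b.
  have -> : a - b = (v2 - v1) * (a * b).
    rewrite -[in LHS](mulr1 a) -bv -[X in _ - X]mulr1 -av; ring.
  by rewrite ler_pM2r.
set d := v1 - u1; have dd : d <= `|d| by exact: ler_norm.
have d0 : 0 <= `|d| by [].
have dm : d * (a * b) <= `|d|.
  by rewrite (le_trans (ler_wpM2r (ltW ab0) dd)) // ler_piMr.
have eu : u1 * (a * b) = b - d * (a * b).
  by rewrite -[X in _ = X - _]mul1r -av /d; ring.
have H1 : m * (1 - d * (a * b)) <= 1 + u2 * (1 - b) - (1 + u1 * (1 - a)).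
  have -> : 1 + u2 * (1 - b) - (1 + u1 * (1 - a)) =
    (u2 - u1) * (1 - b) + u1 * (a - b) by ring.
  have -> : m * (1 - d * (a * b)) = m * (1 - b) + u1 * (m * (a * b)).
    by rewrite [u1 * _]mulrCA eu; ring.
  by rewrite lerD ?ler_wpM2l ?ler_wpM2r //; lra.
split; first by apply: le_trans H1; rewrite ler_wpM2l //; lra.
set U2 := 1 + u2 * _ in H1 *; set U1 := 1 + u1 * _ in H1 *.
have U10 : 0 <= U1 by rewrite /U1 addr_ge0 // mulr_ge0 //; lra.
have eU : U1 * (a * b) = b - d * (a * b) + d * (a * b) * a.
  have -> : U1 = u1 + d * a by rewrite /U1 /d -[X in X + _ = _]av; ring.
  by rewrite mulrDl eu; ring.
have -> : 1 + (1 - b) * U2 - (1 + (1 - a) * U1) =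
    (1 - b) * (U2 - U1) + U1 * (a - b) by ring.
apply: (@le_trans _ _ ((1 - b) * (m * (1 - d * (a * b))) + U1 * (m * (a * b)))).
  rewrite [_ * (m * (1 - _))]mulrCA [U1 * _]mulrCA -mulrDr ler_wpM2l // eU.
  set t := d * (a * b) in dm *.
  have -> : (1 - b) * (1 - t) + (b - t + t * a) = 1 - t * (2 - a - b) by ring.
  have : t * (2 - a - b) <= `|d| * (2 - a - b) by rewrite ler_wpM2r //; lra.
  have : `|d| * (2 - a - b) <= `|d| * 2 by rewrite ler_wpM2l //; lra.
  lra.
by rewrite lerD // ler_wpM2l //; lra.
Qed.

Lemma orbS (R : realType) (p : R * R) (n : nat) : orb p n.+1 = step (orb p n).
Proof. by []. Qed.

Lemma orb_gt1 (R : realType) (p : R * R) (n : nat) :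
  pos_quadrant p -> 1 < (orb p n).1 /\ 1 < (orb p n).2.
Proof.
move=> p0; elim: n => [|n [u1 v1]]; first exact: chart_gt1.
by rewrite orbS; exact: step_gt1.
Qed.

Lemma even_iterates_orb (R : realType) (p : R * R) (n : nat) :
  pos_quadrant p -> even_iterates p n.+1 = unchart (orb p n).
Proof.
move=> p0; elim: n => [|n IH]; first exact: T2_chart.
have [u1 v1] := orb_gt1 n p0.
have -> : even_iterates p n.+2 = T (T (even_iterates p n.+1)) by [].
rewrite IH T2_chart; last exact: unchart_pos.
by rewrite chart_unchart.
Qed.

Lemma gap_orb (R : realType) (p : R * R) (n : nat) : pos_quadrant p ->
  `|gap (orb p n)| <= geometric `|gap (chart p)| (4^-1) n.
Proof.
move=> p0; elim: n => [|n IH]; first by rewrite /= mulr1.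
have [u1 v1] := orb_gt1 n p0.
rewrite orbS (le_trans (gap_step_le v1)) //= exprS mulrCA mulrC.
by rewrite ler_wpM2l.
Qed.

Lemma gap_orb_cvg (R : realType) (p : R * R) : pos_quadrant p ->
  `|gap (orb p n)| @[n --> \oo] --> 0.
Proof.
move=> p0; apply: (@squeeze_cvgr _ _ _ _ (cst 0)
  (geometric `|gap (chart p)| 4^-1)).
- by near=> n; rewrite normr_ge0 gap_orb.
- exact: cvg_cst.
- apply: cvg_geometric; rewrite ger0_norm ?invr_ge0 //.
  by rewrite invf_lt1 // ltr1n.
Unshelve. all: by end_near. Qed.

Lemma orb_cvg (R : realType) (p : R * R) : pos_quadrant p ->
  [/\ (orb p n).1 @[n --> \oo] --> limit_fst p,
      (orb p n).2 @[n --> \oo] --> limit_fst p &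
      forall n, Num.min (orb p n).1 (orb p n).2 <= limit_fst p
                <= Num.max (orb p n).1 (orb p n).2].
Proof.
move=> p0.
pose lo n := Num.min (orb p n).1 (orb p n).2.
pose hi n := Num.max (orb p n).1 (orb p n).2.
have lohi n : [/\ lo n <= (orb p n).1 <= hi n, lo n <= (orb p n).2 <= hi n
    & hi n - lo n = `|gap (orb p n)|].
  rewrite /lo /hi /gap; case: (leP (orb p n).1 (orb p n).2) => h.
    by rewrite !lexx h ger0_norm // subr_ge0.
  by rewrite !lexx ltW // ler0_norm ?opprB // subr_le0 ltW.
have [lol hih] : nondecreasing_seq lo /\ nonincreasing_seq hi.
  have S n : lo n <= lo n.+1 /\ hi n.+1 <= hi n.
    have [h1 h2 _] := lohi n; have [_ v1] := orb_gt1 n p0.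
    have [/andP[? ?] /andP[? ?]] := step_itv v1 h1 h2.
    rewrite {2}/lo {1}/hi orbS; split; first by rewrite le_min; apply/andP.
    by rewrite ge_max; apply/andP.
  by split; [apply/nondecreasing_seqP|apply/nonincreasing_seqP] => n; case: (S n).
have [|hl cl ch] := adjacent_seq lol hih.
  rewrite (_ : hi - lo = fun n => `|gap (orb p n)|); first exact: gap_orb_cvg.
  by apply/funext => n; have [] := lohi n.
have sq (f : nat -> R) : (forall n, lo n <= f n <= hi n) ->
    f n @[n --> \oo] --> limn lo.
  move=> h; apply: (@squeeze_cvgr _ _ _ _ lo hi) => //; last by rewrite -hl.
  by near=> n; exact: h.
have cu : (orb p n).1 @[n --> \oo] --> limn lo.
  by apply: sq => n; have [] := lohi n.
have -> : limit_fst p = limn lo by apply: cvg_lim => //.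
split => // [|n]; first by apply: sq => n; have [] := lohi n.
rewrite (nondecreasing_cvgn_le lol cl) /= -hl.
exact: (nonincreasing_cvgn_ge hih ch).
Unshelve. all: by end_near. Qed.

Lemma limit_fst_gt1 (R : realType) (p : R * R) :
  pos_quadrant p -> 1 < limit_fst p.
Proof.
move=> p0; have [_ _ /(_ 0%N) /andP[h _]] := orb_cvg p0.
by apply: lt_le_trans h; rewrite lt_min; apply/andP; exact: chart_gt1.
Qed.

Lemma cvg_prod (R : realType) (U : Type) (F : set_system U) (f g : U -> R)
    (a b : R) {FF : Filter F} :
  f x @[x --> F] --> a -> g x @[x --> F] --> b ->
  (f x, g x) @[x --> F] --> (a, b).
Proof. exact: cvg_pair. Qed.

Lemma even_iterates_cvg (R : realType) (p : R * R) : pos_quadrant p ->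
  even_iterates p n @[n --> \oo] --> unchart (limit_fst p, limit_fst p).
Proof.
move=> p0; have [cu cv _] := orb_cvg p0; have L1 := limit_fst_gt1 p0.
have c : unchart (orb p n) @[n --> \oo] --> unchart (limit_fst p, limit_fst p).
  suff cq : (orb p n).2 / ((orb p n).2 - 1) @[n --> \oo]
      --> limit_fst p / (limit_fst p - 1) by exact: (cvg_prod cu cq).
  apply: cvgM => //; apply: cvgV.
    by rewrite subr_eq0 gt_eqF.
  by apply: cvgB => //; exact: cvg_cst.
move=> A /c [N _ h]; exists N.+1 => // -[|n] // Nn.
by rewrite /= even_iterates_orb //; exact: h.
Qed.

Lemma limit_period_two (R : realType) (p : R * R) : pos_quadrant p ->
  period_two_set (unchart (limit_fst p, limit_fst p)).
Proof.
move=> p0; have L1 := limit_fst_gt1 p0; split; first exact: unchart_pos.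
by rewrite /unchart /=; field; rewrite subr_eq0 gt_eqF.
Qed.

Lemma even_iterates_limE (R : realType) (p q : R * R) : pos_quadrant p ->
  even_iterates p n @[n --> \oo] --> q ->
  q = unchart (limit_fst p, limit_fst p).
Proof.
move=> p0 h; apply: (cvg_unique _ h (even_iterates_cvg p0)).
exact: norm_hausdorff.
Qed.

Lemma limit_mapE (R : realType) (p : R * R) : pos_quadrant p ->
  limit_map p = unchart (limit_fst p, limit_fst p).
Proof.
move=> p0; apply: even_iterates_limE => //.
pose P := [set q : R * R | even_iterates p n @[n --> \oo] --> q].
have ex : exists q, P q.
  by exists (unchart (limit_fst p, limit_fst p)); exact: even_iterates_cvg.
have H := getPex ex.
exact: H.
Qed.

Lemma stable_setE (R : realType) (q : R * R) : period_two_set q ->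
  stable_set q = [set p | pos_quadrant p /\ limit_fst p = q.1].
Proof.
case: q => x y [[/= x0 y0] xy]; apply/seteqP; split=> p [p0 h]; split=> //.
  by have [] := even_iterates_limE p0 h.
have x1 : x - 1 != 0 by rewrite -h subr_eq0 gt_eqF // limit_fst_gt1.
suff -> : (x, y) = unchart (limit_fst p, limit_fst p).
  exact: even_iterates_cvg.
rewrite h /unchart /=; congr (_, _); apply: (mulIf x1).
by rewrite divfK // mulrBr mulr1 mulrC -xy addrK.
Qed.

Lemma step_cts (R : realType) (p : R * R) : p.2 != 0 ->
  {for p, continuous (@step R)}.
Proof.
move=> v0; have cw : 1 - x.2^-1 @[x --> p] --> 1 - p.2^-1.
  by apply: cvgB; [exact: cvg_cst|apply: cvgV => //; exact: cvg_snd].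
have cu : 1 + x.1 * (1 - x.2^-1) @[x --> p] --> 1 + p.1 * (1 - p.2^-1).
  by apply: cvgD; [exact: cvg_cst|apply: cvgM => //; exact: cvg_fst].
suff cv : 1 + (1 - x.2^-1) * (1 + x.1 * (1 - x.2^-1)) @[x --> p] -->
    1 + (1 - p.2^-1) * (1 + p.1 * (1 - p.2^-1)) by exact: (cvg_prod cu cv).
by apply: cvgD; [exact: cvg_cst|exact: cvgM].
Qed.

Lemma chart_cts (R : realType) (p : R * R) : p.2 != 0 ->
  {for p, continuous (@chart R)}.
Proof.
move=> v0; have ci : x.2^-1 @[x --> p] --> p.2^-1.
  by apply: cvgV => //; exact: cvg_snd.
have cu : 1 + x.1 / x.2 @[x --> p] --> 1 + p.1 / p.2.
  by apply: cvgD; [exact: cvg_cst|apply: cvgM => //; exact: cvg_fst].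
suff cv : 1 + x.2^-1 * (1 + x.1 / x.2) @[x --> p] -->
    1 + p.2^-1 * (1 + p.1 / p.2) by exact: (cvg_prod cu cv).
by apply: cvgD; [exact: cvg_cst|exact: cvgM].
Qed.

Lemma orb_cts (R : realType) (p : R * R) (n : nat) : pos_quadrant p ->
  {for p, continuous (fun q => orb q n)}.
Proof.
move=> p0; elim: n => [|n IH].
  by apply: chart_cts; rewrite gt_eqF //; case: p0.
apply: (continuous_comp IH); apply: step_cts.
by have [_ v1] := orb_gt1 n p0; rewrite gt_eqF // (lt_trans ltr01).
Qed.

Lemma pos_quadrant_open (R : realType) : open (@pos_quadrant R).
Proof.
have -> : @pos_quadrant R = fst @^-1` [set x | 0 < x] `&` snd @^-1` [set x | 0 < x].
  by apply/seteqP; split=> p [].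
apply: openI; apply: open_comp; try exact: open_gt.
- by move=> p _; exact: cvg_fst.
- by move=> p _; exact: cvg_snd.
Qed.

Lemma dist_limit_fst (R : realType) (p : R * R) (n : nat) : pos_quadrant p ->
  `|(orb p n).1 - limit_fst p| <= `|gap (orb p n)|.
Proof.
move=> p0; have [_ _ /(_ n)] := orb_cvg p0; rewrite /gap.
move: (limit_fst p) (orb p n) => L [u v] /=.
by case: (leP u v) => uv /andP[h1 h2];
  [rewrite [`|v - _|]ger0_norm|rewrite [`|v - _|]ltr0_norm];
  rewrite ?ler_norml; lra.
Qed.

Lemma limit_fst_cts (R : realType) (p : R * R) : pos_quadrant p ->
  {for p, continuous (@limit_fst R)}.
Proof.
move=> p0; apply/cvgrPdist_lt => e e0.
have e3 : 0 < e / 3 by rewrite divr_gt0.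
have [N _ hN] := cvgr_lt _ (gap_orb_cvg p0) _ e3.
have {}hN : `|gap (orb p N)| < e / 3 by apply: hN => /=.
have co := @orb_cts R p N p0.
have c1 : (orb q N).1 @[q --> p] --> (orb p N).1.
  by apply: (cvg_comp _ _ co); exact: cvg_fst.
have c2 : (orb q N).2 @[q --> p] --> (orb p N).2.
  by apply: (cvg_comp _ _ co); exact: cvg_snd.
have cg : `|gap (orb q N)| @[q --> p] --> `|gap (orb p N)|.
  by apply: cvg_norm; exact: cvgB.
near=> q.
have q0 : pos_quadrant q.
  near: q; exact: (open_nbhs_nbhs (conj (@pos_quadrant_open R) p0)).
have h1 : `|gap (orb q N)| < e / 3 by near: q; exact: cvgr_lt cg _ hN.
have h2 : `|(orb p N).1 - (orb q N).1| < e / 3.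
  by near: q; exact: cvgr_dist_lt c1 _ e3.
have h3 := le_lt_trans (dist_limit_fst N p0) hN.
have h4 := le_lt_trans (dist_limit_fst N q0) h1.
move: h2 h3 h4; rewrite !ltr_norml => /andP[? ?] /andP[? ?] /andP[? ?].
by apply/andP; split; lra.
Unshelve. all: by end_near. Qed.

Lemma limit_map_cts (R : realType) :
  {within @pos_quadrant R, continuous (@limit_map R)}.
Proof.
apply: (@subspace_eq_continuous _ _ _
  (fun p : R * R => unchart (limit_fst p, limit_fst p))).
  by move=> p; rewrite inE => p0; exact/esym/limit_mapE.
apply: continuous_in_subspaceT => p; rewrite inE => p0.
have c := limit_fst_cts p0.
suff cq : limit_fst q / (limit_fst q - 1) @[q --> p]
    --> limit_fst p / (limit_fst p - 1) by exact: (cvg_prod c cq).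
apply: cvgM => //; apply: cvgV.
  by rewrite subr_eq0 gt_eqF // limit_fst_gt1.
by apply: cvgB => //; exact: cvg_cst.
Qed.

Lemma chart_lt (R : realType) (p q : R * R) :
  pos_quadrant p -> pos_quadrant q -> p.1 <= q.1 -> q.2 <= p.2 -> p != q ->
  (chart p).1 < (chart q).1 /\ (chart p).2 < (chart q).2.
Proof.
case: p q => [x y] [x' y'] [/= x0 y0] [/= x0' y0'] xx yy ne; rewrite /chart /=.
have iy : y^-1 <= y'^-1 by rewrite lef_pV2.
have i0 : 0 < y^-1 by rewrite invr_gt0.
have i0' : 0 < y'^-1 by rewrite invr_gt0.
have h : x / y < x' / y'.
  have [E|nx] := eqVneq x x'; last first.
    have ltx : x < x' by rewrite lt_neqAle nx.
    by apply: (@lt_le_trans _ _ (x' / y)); rewrite ?ltr_pM2r ?ler_pM2l.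
  rewrite E ltr_pM2l // ltf_pV2 // lt_neqAle yy andbT {xx}.
  subst x'; by apply: contra_neq ne => ->.
have xy0 : 0 < x / y by rewrite divr_gt0.
split; first by rewrite ltrD2l.
rewrite ltrD2l (@lt_le_trans _ _ (y^-1 * (1 + x' / y'))) //.
  by rewrite ltr_pM2l // ltrD2l.
by rewrite ler_wpM2r //; lra.
Qed.

Lemma step_lt (R : realType) (p q : R * R) :
  1 < p.1 -> 1 < p.2 -> 1 < q.1 -> 1 < q.2 -> p.1 < q.1 -> p.2 < q.2 ->
  (step p).1 < (step q).1 /\ (step p).2 < (step q).2.
Proof.
case: p q => [u v] [u' v'] /= hu hv hu' hv' uu vv; rewrite /step /=.
have [a0 a1] := inv_gt1 hv; have [b0 b1] := inv_gt1 hv'.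
have ba : v'^-1 < v^-1 by rewrite ltf_pV2 // posrE; lra.
move: (v^-1) (v'^-1) a0 a1 b0 b1 ba => a b a0 a1 b0 b1 ba.
have h : u * (1 - a) < u' * (1 - b) by nra.
have h0 : 0 < u * (1 - a) by rewrite mulr_gt0; lra.
split; first lra.
by rewrite ltrD2l; nra.
Qed.

Lemma limit_fst_lt (R : realType) (p q : R * R) :
  pos_quadrant p -> pos_quadrant q -> p.1 <= q.1 -> q.2 <= p.2 -> p != q ->
  limit_fst p < limit_fst q.
Proof.
move=> p0 q0 h1 h2 ne.
have lt_orb n : (orb p n).1 < (orb q n).1 /\ (orb p n).2 < (orb q n).2.
  elim: n => [|n [IH1 IH2]]; first exact: chart_lt.
  have [? ?] := orb_gt1 n p0; have [? ?] := orb_gt1 n q0.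
  by rewrite !orbS; exact: step_lt.
have e8 : 0 < 8^-1 :> R by rewrite invr_gt0.
have [N _ hN] := cvgr_lt _ (gap_orb_cvg p0) _ e8.
have {hN} dN n : `|gap (orb p (n + N)%N)| < 8^-1 by apply: hN => /=; exact: leq_addl.
have [c c0 [hc1 hc2]] : exists2 c, 0 < c & c <= (orb q N).1 - (orb p N).1 /\
    c <= (orb q N).2 - (orb p N).2.
  have [l1 l2] := lt_orb N.
  exists (Num.min ((orb q N).1 - (orb p N).1) ((orb q N).2 - (orb p N).2)).
    by rewrite lt_min !subr_gt0 l1 l2.
  by split; rewrite ge_min lexx ?orbT.
(* The factor 1 - 2|gap| lost at each step is absorbed by the decrease of
   4|gap|, since the gap shrinks by a factor 4. *)
have sep n : let m := c * (1 / 2 + 4 * `|gap (orb p (n + N)%N)|) in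
    m <= (orb q (n + N)%N).1 - (orb p (n + N)%N).1 /\
    m <= (orb q (n + N)%N).2 - (orb p (n + N)%N).2.
  elim: n => [|n [IH1 IH2]].
    have := dN 0%N; rewrite add0n => d8 m.
    have mc : m <= c by rewrite /m ler_piMr //; lra.
    by split; apply: le_trans mc _.
  rewrite addSn !orbS; set P := orb p _ in IH1 IH2 *; set Q := orb q _ in IH1 IH2 *.
  have [u1 v1] : 1 < P.1 /\ 1 < P.2 by exact: orb_gt1.
  have [u1' v1'] : 1 < Q.1 /\ 1 < Q.2 by exact: orb_gt1.
  have d8 : `|gap P| < 8^-1 by exact: dN.
  have gs := gap_step_le v1.
  set m := c * _ in IH1 IH2.
  have g0 : 0 <= `|gap P| by [].
  have m0 : 0 <= m by rewrite /m mulr_ge0 //; lra.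
  have [s1 s2] := step_expand u1 v1 u1' v1' m0 IH1 IH2.
  have le_m : c * (1 / 2 + 4 * `|gap (step P)|) <= m * (1 - 2 * `|gap P|).
    rewrite /m -mulrA ler_wpM2l ?(ltW c0) //; nra.
  by split; apply: le_trans le_m _.
have [cp _ _] := orb_cvg p0; have [cq _ _] := orb_cvg q0.
rewrite -subr_gt0 (@lt_le_trans _ _ (c / 2)) ?divr_gt0 //.
apply: (@ler_cvg_to _ \oo _ _ (fun=> c / 2) (fun n => (orb q n).1 - (orb p n).1)).
- exact: cvg_cst.
- exact: cvgB.
- exists N => // n /= Nn; have [+ _] := sep (n - N)%N; rewrite subnK //.
  apply: le_trans; rewrite ler_pM2l // mul1r lerDl mulr_ge0 //.
Qed.

Lemma limit_fst_IVT (R : realType) (g : R -> R * R) (a b l : R) :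
  a <= b -> continuous g -> (forall t, a <= t <= b -> pos_quadrant (g t)) ->
  Num.min (limit_fst (g a)) (limit_fst (g b)) <= l
    <= Num.max (limit_fst (g a)) (limit_fst (g b)) ->
  exists2 t, a <= t <= b & limit_fst (g t) = l.
Proof.
move=> ab cg pg hl.
have [|t tab <-] := @IVT R (@limit_fst R \o g) a b l ab _ hl.
  apply: continuous_in_subspaceT => t; rewrite inE /= in_itv /= => tab.
  by apply: continuous_comp; [exact: cg|apply: limit_fst_cts; exact: pg].
by exists t; rewrite // -in_itv.
Qed.

Lemma vertical_cts (R : realType) (x : R) : continuous (fun y : R => (x, y)).
Proof. move=> y; apply: cvg_prod; [exact: cvg_cst|exact: cvg_id]. Qed.

Lemma horizontal_cts (R : realType) (y : R) : continuous (fun x : R => (x, y)).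
Proof. move=> x; apply: cvg_prod; [exact: cvg_id|exact: cvg_cst]. Qed.

Lemma level_increasing_curve (R : realType) (l : R) :
  increasing_curve [set p : R * R | pos_quadrant p /\ limit_fst p = l].
Proof.
pose C := [set p : R * R | pos_quadrant p /\ limit_fst p = l].
have C_lt (x1 x2 y1 y2 : R) : C (x1, y1) -> C (x2, y2) -> x1 < x2 -> y1 < y2.
  move=> [p1 e1] [p2 e2] x12; rewrite ltNge; apply/negP => y21.
  have : limit_fst (x1, y1) < limit_fst (x2, y2).
    by apply: limit_fst_lt => //=; [exact: ltW|case: eqVneq x12 => // -[->]; rewrite ltxx].
  by rewrite e1 e2 ltxx.
have C_fun (x y1 y2 : R) : C (x, y1) -> C (x, y2) -> y1 = y2.
  have W (z1 z2 : R) : C (x, z1) -> C (x, z2) -> z1 < z2 -> False.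
    move=> [p1 e1] [p2 e2] z12.
    have : limit_fst (x, z2) < limit_fst (x, z1).
      apply: limit_fst_lt => //=; first exact: ltW.
      by apply/eqP => -[E]; rewrite E ltxx in z12.
    by rewrite e1 e2 ltxx.
  by move=> c1 c2; case: (ltgtP y1 y2) => // h; exfalso; [exact: W h|exact: (W y2 y1)].
pose I := [set x | exists y, C (x, y)].
pose f x := get (fun y => C (x, y)).
have fC x : I x -> C (x, f x) by move=> Ix; exact: (@getPex _ (fun y => C (x, y))).
exists I, f; split.
- move=> x1 x2 [y1 c1] [y2 c2] x /andP[x1x xx2].
  have [<-|n1] := eqVneq x1 x; first by exists y1.
  have [->|n2] := eqVneq x x2; first by exists y2.
  have lt1 : x1 < x by rewrite lt_neqAle n1.
  have lt2 : x < x2 by rewrite lt_neqAle n2.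
  have y12 : y1 < y2 by apply: C_lt c1 c2 _; exact: lt_trans lt2.
  case: c1 c2 => [[/= x10 y10] e1] [[/= x20 y20] e2].
  have x0 : 0 < x by exact: lt_trans lt1.
  have g1 : l < limit_fst (x, y1).
    by rewrite -e1; apply: limit_fst_lt => //=; apply/eqP => -[E]; rewrite E ltxx in lt1.
  have g2 : limit_fst (x, y2) < l.
    by rewrite -e2; apply: limit_fst_lt => //=; apply/eqP => -[E]; rewrite E ltxx in lt2.
  have [||||y /andP[yy _] e] := @limit_fst_IVT R (fun y => (x, y)) y1 y2 l.
  + exact: ltW.
  + exact: vertical_cts.
  + by move=> t /andP[t1 _]; split=> //=; exact: lt_le_trans t1.
  + by rewrite ge_min le_max (ltW g1) (ltW g2) orbT.
  + by exists y; split=> //; split=> //=; exact: lt_le_trans yy.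
- apply/subspace_continuousP => x Ix; apply/cvgrPdist_lt => e e0.
  have [[/= x0 y0] ex] := fC x Ix.
  set y := f x in y0 ex *.
  pose d := Num.min e y / 2.
  have d0 : 0 < d by rewrite divr_gt0 // lt_min e0.
  have [de dy] : d < e /\ d < y.
    have m0 : 0 < Num.min e y by rewrite lt_min e0.
    have : Num.min e y <= e by rewrite ge_min lexx.
    have : Num.min e y <= y by rewrite ge_min lexx orbT.
    by rewrite /d; split; lra.
  have g1 : l < limit_fst (x, y - d).
    rewrite -ex; apply: limit_fst_lt => //=; rewrite ?lerBlDr ?lerDl ?(ltW d0) //.
      by split=> //=; rewrite subr_gt0.
    by apply/eqP => -[]; lra.
  have g2 : limit_fst (x, y + d) < l.
    rewrite -ex; apply: limit_fst_lt => //=; rewrite ?lerDl ?(ltW d0) //.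
      by split=> //=; rewrite addr_gt0.
    by apply/eqP => -[]; lra.
  have c z : 0 < z -> limit_fst (t, z) @[t --> x] --> limit_fst (x, z).
    by move=> z0; apply: (continuous_comp (@horizontal_cts R z x)); exact: limit_fst_cts.
  rewrite near_withinE; near=> t => It.
  have [pt et] := fC t It.
  have h1 : l < limit_fst (t, y - d).
    by near: t; apply: cvgr_gt g1; apply: c; rewrite subr_gt0.
  have h2 : limit_fst (t, y + d) < l.
    by near: t; apply: cvgr_lt g2; apply: c; rewrite addr_gt0.
  have t0 : 0 < t by case: pt.
  have k1 : y - d < f t.
    rewrite ltNge; apply/negP => k.
    have [E|ne] := eqVneq (t, y - d) (t, f t); first by rewrite E et ltxx in h1.
    have : limit_fst (t, y - d) < limit_fst (t, f t).
      by apply: limit_fst_lt => //=; split=> //=; rewrite subr_gt0.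
    by rewrite et => /(lt_trans h1); rewrite ltxx.
  have k2 : f t < y + d.
    rewrite ltNge; apply/negP => k.
    have [E|ne] := eqVneq (t, f t) (t, y + d); first by rewrite -E et ltxx in h2.
    have : limit_fst (t, f t) < limit_fst (t, y + d).
      by apply: limit_fst_lt => //=; split=> //=; rewrite addr_gt0.
    by rewrite et => /lt_trans /(_ h2); rewrite ltxx.
  by rewrite -[from_subspace _ f x]/y -[from_subspace _ f t]/(f t) ltr_norml; apply/andP; split; lra.
- by move=> s t /fC cs /fC ct; exact: C_lt cs ct.
- apply/seteqP; split=> -[x y] /=.
    move=> Cxy; have Ix : I x by exists y.
    by split=> //; apply: C_fun Cxy (fC _ Ix).
  by case=> Ix ->; exact: fC.
Unshelve. all: by end_near. Qed.

Lemma level_unbounded (R : realType) (l : R) : 1 < l ->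
  ~ bounded_set [set p : R * R | pos_quadrant p /\ limit_fst p = l].
Proof.
move=> l1 [B [_ hB]].
have l0 : 0 < l by lra.
have lm0 : 0 < l - 1 by lra.
have i0 : 0 < 2 / (l - 1) by rewrite divr_gt0.
pose M := Num.max 0 B + 2 + 2 / (l - 1).
have [M2 BM] : 2 < M /\ B + 1 < M.
  have : 0 <= Num.max 0 B by rewrite le_max lexx.
  have : B <= Num.max 0 B by rewrite le_max lexx orbT.
  by rewrite /M; split; lra.
have M0 : 0 < M by lra.
have Ml : 1 + 2 / M < l.
  rewrite -ltrBrDl ltr_pdivrMr // mulrC -ltr_pdivrMr //.
  have : 0 <= Num.max 0 B by rewrite le_max lexx.
  by rewrite /M; lra.
have iM0 : 0 < M^-1 by rewrite invr_gt0.
have iM1 : M^-1 < 1 by rewrite invf_lt1 //; lra.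
have il0 : 0 < l^-1 by rewrite invr_gt0.
have il1 : l^-1 < 1 by rewrite invf_lt1.
(* limit_fst changes sign relative to l along the path (1, M) -- (M, M) --
   (M, 1/l), which runs on the boundary of the box. *)
suff [p [p0 ep] Mp] : exists2 p : R * R, pos_quadrant p /\ limit_fst p = l &
    M <= p.1 \/ M <= p.2.
  have := hB (M - 1) ltac:(lra) p (conj p0 ep).
  rewrite /= /Num.norm /= ge_max => /andP[n1 n2].
  have := le_trans (ler_norm _) n1; have := le_trans (ler_norm _) n2.
  by case: Mp; lra.
have low : limit_fst (1, M) < l.
  have p0 : pos_quadrant (1 : R, M) by [].
  have [_ _ /(_ 0%N) /andP[_ h]] := orb_cvg p0.
  apply: le_lt_trans h _; rewrite gt_max /=; apply/andP; split; first by lra.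
  by nra.
have high : l < limit_fst (M, l^-1).
  have p0 : pos_quadrant (M, l^-1) by [].
  have [_ _ /(_ 0%N) /andP[h _]] := orb_cvg p0.
  apply: lt_le_trans h; rewrite lt_min /= invrK; apply/andP; split; nra.
have [mid|mid] := leP (limit_fst (M, M)) l.
  have [||||y /andP[y0 _] e] := @limit_fst_IVT R (fun y => (M, y)) l^-1 M l.
  - by lra.
  - exact: vertical_cts.
  - by move=> t /andP[t1 _]; split=> //=; lra.
  - by rewrite ge_min le_max mid (ltW high) orbT.
  - by exists (M, y); [split=> //; split=> //=; lra|left].
have [||||x /andP[x0 _] e] := @limit_fst_IVT R (fun x => (x, M)) 1 M l.
- by lra.
- exact: horizontal_cts.
- by move=> t /andP[t1 _]; split=> //=; lra.
- by rewrite ge_min le_max (ltW low) (ltW mid) orbT.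
- by exists (x, M); [split=> //; split=> //=; lra|right].
Qed.

Theorem theorem12 (R : realType) :
  [/\ (forall x : nat -> R, is_solution x ->
         exists q : R * R, period_two_set q /\
           even_iterates (x 0%N, x 1%N) n @[n --> \oo] --> q),
      (forall q : R * R, period_two_set q ->
         increasing_curve (stable_set q) /\ ~ bounded_set (stable_set q))
    & {within @pos_quadrant R, continuous (@limit_map R)}].
Proof.
split; last exact: limit_map_cts.
  move=> x [x0 x1 _]; have p0 : pos_quadrant (x 0%N, x 1%N) by [].
  exists (unchart (limit_fst (x 0%N, x 1%N), limit_fst (x 0%N, x 1%N))).
  by split; [exact: limit_period_two|exact: even_iterates_cvg].
move=> q hq; rewrite stable_setE //; split; first exact: level_increasing_curve.
apply: level_unbounded; case: q hq => x y [[/= x0 y0] xy].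
by nra.
Qed.
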